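(* For every integer $n\geq 5$, the Kneser graph $KG_{n,2}$ has property $(G)$. That is, with $V$ the vertex set and $A$ the adjacency matrix of $KG_{n,2}$, the planar algebra $\mathscr{P}^{KG_{n,2}}_\bullet$ of $\mathrm{Aut}(KG_{n,2})$-invariant functions on the powers of $V$ is generated, as a planar algebra, by $A$: one has $\mathscr{A}_k=\mathscr{P}^{KG_{n,2}}_k$ for all $k\geq 0$, where $\mathscr{A}_\bullet$ is the planar subalgebra generated by $A$.
   Context: The Kneser graph $KG_{n,2}$ has as vertices the $2$-element subsets of $\{1,\dots,n\}$; two vertices are adjacent iff they are disjoint. For $n\ge 5$ its automorphism group is $S_n$ acting in the natural way. Spin model and group-action model. Let $\Gamma$ be a finite graph with vertex set $V$ and adjacency matrix $A$. The spin model on $V$ is the family $\mathscr{P}_k=\{f:V^k\to\mathbb{C}\}$, $k\ge 0$ (with $\mathscr{P}_0=\mathbb{C}$). The group $\mathrm{Aut}(\Gamma)$ acts diagonally on $V^k$ and hence on $\mathscr{P}_k$; $\mathscr{P}^\Gamma_k$ denotes the subspace of fixed points. Planar subalgebra generated by $A$. The planar operations on $\mathscr{P}_\bullet$ are linear combinations within each $\mathscr{P}_k$ and: - tensor product $(f\otimes g)(x_1,\dots,x_k,y_1,\dots,y_m)=f(x_1,\dots,x_k)\,g(y_1,\dots,y_m)$; - contraction of adjacent variables $(C_{i,i+1}f)(x_1,\dots,x_{i-1},x_{i+2},\dots,x_k)=\sum_{x\in V} f(x_1,\dots,x_{i-1},x,x,x_{i+2},\dots,x_k)$; - cyclic rotation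 of the variables $f(x_1,\dots,x_k)\mapsto f(x_2,\dots,x_k,x_1)$. Arbitrary permutations of the variables are NOT among the planar operations. $\mathscr{A}_\bullet=(\mathscr{A}_k)_{k\ge 0}$ denotes the smallest family of linear subspaces $\mathscr{A}_k\subset \mathscr{P}_k$ that contains - the Temperley-Lieb elements: the constant $1\in\mathscr{P}_0$, the constant function $1\in\mathscr{P}_1$, $I(x,y)=\delta_{x,y}$ in $\mathscr{P}_2$, and $\mathrm{GHZ}\in\mathscr{P}_3$, where $\mathrm{GHZ}(x,y,z)=1$ if $x=y=z$ and $0$ otherwise; - the adjacency matrix $A\in\mathscr{P}_2$, viewed as the function $A(x,y)$ equal to $1$ if $x,y$ are adjacent and $0$ otherwise; and is closed under the planar operations. One always has $\mathscr{A}_k\subset\mathscr{P}^\Gamma_k$. The graph $\Gamma$ has property $(G)$ if $\mathscr{A}_k=\mathscr{P}^\Gamma_k$ for all $k\ge 0$. *)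

(* Defs.v *)
From HB Require Import structures.
From mathcomp Require Import all_boot all_order all_fingroup all_algebra.
From mathcomp Require Import complex reals.
Set Implicit Arguments.
Unset Strict Implicit.
Unset Printing Implicit Defensive.
Import GRing.Theory.
Local Open Scope ring_scope.

(* The complex numbers are R[i] for R : realType.  The regular-module alias ^o
   makes P_k = spin_space R V k canonically a vector space over R[i].
   A point (x_1, ..., x_k) of V^k is a finite function on 'I_k, so that x_1 is
   x 0; for k = 0 there is exactly one point, and P_0 is a copy of R[i]. *)
Definition spin_space (R : realType) (V : finType) (k : nat) :=
  {ffun {ffun 'I_k -> V} -> R[i]^o}.

Section PlanarOperations.
Variables (R : realType) (V : finType).
Local Notation P := (spin_space R V).

Definition const_one (k : nat) : P k := [ffun=> 1].

Definition spin_id : P 2 := [ffun x : {ffun 'I_2 -> V} => (x 0 == x 1)%:R].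

Definition spin_ghz : P 3 :=
  [ffun x : {ffun 'I_3 -> V} => ((x 0 == x 1) && (x 1 == x 2))%:R].

Definition spin_adj (e : rel V) : P 2 :=
  [ffun x : {ffun 'I_2 -> V} => (e (x 0) (x 1))%:R].

Definition spin_tensor (k m : nat) (f : P k) (g : P m) : P (k + m) :=
  [ffun x : {ffun 'I_(k + m) -> V} =>
     f [ffun i => x (lshift m i)] * g [ffun j => x (rshift k j)]].

(* The tuple obtained from x by inserting v so that it occupies position i. *)
Definition insert_at (k : nat) (i : 'I_k.+1) (v : V) (x : {ffun 'I_k -> V}) :
    {ffun 'I_k.+1 -> V} :=
  [ffun j => if unlift i j is Some j' then x j' else v].

(* Inserting v twice at position i puts it at the adjacent positions i, i+1;
   all k+1 pairs of adjacent positions in 'I_(k+2) arise in this way. *)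
Definition spin_contract (k : nat) (i : 'I_k.+1) (f : P k.+2) : P k :=
  [ffun x : {ffun 'I_k -> V} =>
     \sum_(v : V) f (insert_at (widen_ord (leqnSn k.+1) i) v
                               (insert_at i v x))].

(* ordS is the cyclic successor, so the value is f (x_2, ..., x_k, x_1). *)
Definition spin_rot (k : nat) (f : P k) : P k :=
  [ffun x : {ffun 'I_k -> V} => f [ffun i => x (ordS i)]].

(* Membership in the k-th space of the planar subalgebra generated by the
   adjacency matrix of e, the least family of linear subspaces containing the
   generators and closed under the planar operations. *)
Inductive planar_gen (e : rel V) : forall k : nat, P k -> Prop :=
  | Gen_one0 : planar_gen e (const_one 0)
  | Gen_one1 : planar_gen e (const_one 1)
  | Gen_id : planar_gen e spin_id
  | Gen_ghz : planar_gen e spin_ghz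
  | Gen_adj : planar_gen e (spin_adj e)
  | Gen_zero k : planar_gen e (0 : P k)
  | Gen_add k (f g : P k) :
      planar_gen e f -> planar_gen e g -> planar_gen e (f + g)
  | Gen_scale k (a : R[i]) (f : P k) :
      planar_gen e f -> planar_gen e (a *: f)
  | Gen_tensor k m (f : P k) (g : P m) :
      planar_gen e f -> planar_gen e g -> planar_gen e (spin_tensor f g)
  | Gen_contract k (i : 'I_k.+1) (f : P k.+2) :
      planar_gen e f -> planar_gen e (spin_contract i f)
  | Gen_rot k (f : P k) :
      planar_gen e f -> planar_gen e (spin_rot f).

Definition graph_aut (e : rel V) : {set {perm V}} :=
  [set s : {perm V} | [forall x, forall y, e (s x) (s y) == e x y]].

Definition spin_act (k : nat) (s : {perm V}) (f : P k) : P k :=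
  [ffun x : {ffun 'I_k -> V} => f [ffun i => (s^-1)%g (x i)]].

Definition aut_invariant (e : rel V) (k : nat) (f : P k) : Prop :=
  forall s : {perm V}, s \in graph_aut e -> spin_act s f = f.

End PlanarOperations.

Definition property_G (R : realType) (V : finType) (e : rel V) : Prop :=
  forall (k : nat) (f : spin_space R V k),
    planar_gen e f <-> aut_invariant e f.

Definition kneser_vertex (n : nat) := {s : {set 'I_n} | #|s| == 2%N}.

Definition kneser_adj (n : nat) : rel (kneser_vertex n) :=
  fun s t => [disjoint val s & val t].

(* Main.v *)
Require Import Defs.
From mathcomp Require Import all_boot all_order all_fingroup all_algebra.
From mathcomp Require Import complex reals zify ring.
Set Implicit Arguments.
Unset Strict Implicit.
Unset Printing Implicit Defensive.
Import GRing.Theory Num.Theory.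
Local Open Scope ring_scope.

(* The point is that the crossing d_{ac} d_{bd}, a function of (a, b, c, d), is
   planar.  Once it is, all permutations of the variables are allowed, and the
   indicator functions of the orbits of Aut(Gamma) are obtained by summing out
   the variables of a product of binary functions.

   View the vertices as edges of K_n.  Two of them are equal, meet in one
   point, or are adjacent (disjoint), so the crossing splits into three parts.
   The relation "a, b, c are the sides of a triangle", i.e. a + b + c = 0 as
   vectors over F_2, is planar: among pairwise meeting edges, the number of
   common neighbours in KG_{n,2} is C(n-3,2) for a triangle and C(n-4,2) for a
   star.  A vertex v inside the square a, b, c, d forming triangles with
   (a, b), (b, c) and (c, d) forces a = c and b = d, which gives the crossing
   of edges meeting in one point.  For disjoint a and b, replace b by two edges
   v, w meeting a and forming a triangle with b; a crosses v, then w, and v, w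
   are merged into b again. *)

(** * Planar operations on functions of lists *)

Section ListForm.
Variables (R : realType) (V : finType) (e : rel V).
Local Notation C := (R[i]).

Lemma nth_codom_ffun (k : nat) (x : {ffun 'I_k -> V}) v0 (i : 'I_k) :
  nth v0 (codom x) i = x i.
Proof.
by rewrite /codom /image_mem (nth_map i) ?size_enum_ord // nth_ord_enum.
Qed.

Lemma size_codom_ord (k : nat) (x : {ffun 'I_k -> V}) : size (codom x) = k.
Proof. by rewrite size_codom card_ord. Qed.

Lemma codom_seqP (k : nat) (x : {ffun 'I_k -> V}) (s : seq V) :
  size s = k -> (forall v0 (i : 'I_k), x i = nth v0 s i) -> codom x = s.
Proof.
case: s => [|v0 s] sz H; first by apply/nilP; rewrite /nilp size_codom_ord -sz.
apply: (@eq_from_nth _ v0); rewrite size_codom_ord // => i ik.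
by rewrite (nth_codom_ffun x v0 (Ordinal ik)) (H v0).
Qed.

(* Functions on V^k are represented by functions on all lists, of which only
   the values at lists of length k matter; no casts between V^(k + m) and
   V^(m + k) are then needed. *)
Definition planar (k : nat) (F : seq V -> C) : Prop :=
  planar_gen e ([ffun x : {ffun 'I_k -> V} => F (codom x)] : spin_space R V k).

Lemma planar_ext k F G :
  (forall s, size s = k -> F s = G s) -> planar k F -> planar k G.
Proof.
move=> FG; rewrite /planar; congr planar_gen.
by apply/ffunP => x; rewrite !ffunE FG // size_codom_ord.
Qed.

Lemma planar_of_gen k (f : spin_space R V k) (F : seq V -> C) :
  planar_gen e f -> (forall x, f x = F (codom x)) -> planar k F.
Proof.
by move=> pf fF; rewrite /planar; congr planar_gen: pf; apply/ffunP => x; rewrite ffunE.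
Qed.

Lemma planar_add k F G :
  planar k F -> planar k G -> planar k (fun s => F s + G s).
Proof. by move=> pF pG; apply: (planar_of_gen (Gen_add pF pG)) => x; rewrite !ffunE. Qed.

Lemma planar_scale k a F : planar k F -> planar k (fun s => a * F s).
Proof. by move=> pF; apply: (planar_of_gen (Gen_scale a pF)) => x; rewrite !ffunE. Qed.

Lemma planar_zero k : planar k (fun=> 0).
Proof. by apply: (planar_of_gen (Gen_zero _ _ _)) => x; rewrite !ffunE. Qed.

Lemma planar_sum k (I : finType) (F : I -> seq V -> C) :
  (forall i, planar k (F i)) -> planar k (fun s => \sum_i F i s).
Proof.
move=> pF; rewrite /index_enum; elim: (Finite.enum I) => [|i r IH].
  by apply: planar_ext (planar_zero k) => s _; rewrite big_nil.
by apply: planar_ext (planar_add (pF i) IH) => s _; rewrite big_cons.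
Qed.

Lemma planar_tensor k m F G : planar k F -> planar m G ->
  planar (k + m) (fun s => F (take k s) * G (drop k s)).
Proof.
move=> pF pG; apply: (planar_of_gen (Gen_tensor pF pG)) => x; rewrite !ffunE.
have sx := size_codom_ord x.
congr (F _ * G _); apply: codom_seqP.
- rewrite size_take sx; case: ltnP => //.
  by rewrite -{2}[k]addn0 leq_add2l leqn0 => /eqP->; rewrite addn0.
- by move=> v0 i; rewrite ffunE nth_take // -(nth_codom_ffun x v0).
- by rewrite size_drop sx addKn.
- by move=> v0 i; rewrite ffunE nth_drop -(nth_codom_ffun x v0).
Qed.

Lemma codom_insert_at k (i : 'I_k.+1) v (x : {ffun 'I_k -> V}) :
  codom (insert_at i v x) = take i (codom x) ++ v :: drop i (codom x).
Proof.
have sx := size_codom_ord x; have ik : (i <= k)%N by rewrite -ltnS.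
have sT : size (take i (codom x)) = i by rewrite size_takel ?sx.
apply: codom_seqP => [|v0 j].
  by rewrite size_cat /= sT size_drop sx addnS subnKC.
rewrite ffunE nth_cat sT; case: unliftP => [j' ->|->] /=; last by rewrite ltnn subnn.
rewrite /bump; case: (leqP i j') => ij; rewrite /= ?add1n ?add0n.
  rewrite ltnNge (leq_trans ij) //= subSn //= nth_drop subnKC //.
  by rewrite nth_codom_ffun.
by rewrite ij nth_take // nth_codom_ffun.
Qed.

Lemma planar_contract k i F : (i <= k)%N -> planar k.+2 F ->
  planar k (fun s => \sum_v F (take i s ++ v :: v :: drop i s)).
Proof.
move=> ik pF; pose j := Ordinal (ik : (i < k.+1)%N).
apply: (planar_of_gen (Gen_contract j pF)) => x; rewrite ffunE; apply: eq_bigr => v _.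
rewrite ffunE !codom_insert_at /=; congr F.
have sT : size (take i (codom x)) = i by rewrite size_takel ?size_codom_ord.
by rewrite take_cat drop_cat sT ltnn subnn /= cats0.
Qed.

Lemma planar_rot1 k F : planar k F -> planar k (fun s => F (rot 1 s)).
Proof.
move=> pF; apply: (planar_of_gen (Gen_rot pF)) => x; rewrite !ffunE; congr F.
case: k F pF x => [|k] F pF x.
  by rewrite !(size0nil (size_codom_ord _)).
apply: codom_seqP => [|v0 i]; first by rewrite size_rot size_codom_ord.
have sx := size_codom_ord x.
rewrite ffunE -(nth_codom_ffun x v0) /= /rot nth_cat size_drop sx subn1 /=.
(* The last index is the only one where [ordS] wraps around, to 0. *)
have := ltn_ord i; rewrite ltnS leq_eqVlt => /orP[/eqP ->|ik].
  by rewrite modnn ltnn subnn nth_take.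
by rewrite modn_small ?ltnS // ik nth_drop.
Qed.

Lemma planar_rot k i F : (i <= k)%N -> planar k F -> planar k (fun s => F (rot i s)).
Proof.
elim: i F => [|i IH] F ik pF; first by apply: planar_ext pF => s _; rewrite rot0.
apply: planar_ext (IH _ (ltnW ik) (planar_rot1 pF)) => s sz.
by rewrite -rotS ?sz.
Qed.

(** In the tensor product the last variable of [F] and the first of [G] are adjacent, at positions
    [k] and [k.+1], so they can be contracted. *)
Lemma planar_glue k m F G : planar k.+1 F -> planar m.+1 G ->
  planar (k + m) (fun s => \sum_v F (rcons (take k s) v) * G (v :: drop k s)).
Proof.
move=> pF pG; have := planar_tensor pF pG; rewrite addSn addnS => pT.
apply: planar_ext (planar_contract (leq_addr m k) pT) => s sz.
have sT : size (take k s) = k by rewrite size_takel // sz leq_addr.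
apply: eq_bigr => v _.
by rewrite -cat_rcons take_size_cat ?drop_size_cat // size_rcons sT.
Qed.

(* The two glued strings are nested, hence the order of v and w. *)
Lemma planar_glue2 k m F G : planar k.+2 F -> planar m.+2 G ->
  planar (k + m) (fun s => \sum_v \sum_w
     F (take k s ++ [:: v; w]) * G (w :: v :: drop k s)).
Proof.
move=> pF pG; have := planar_glue pF pG; rewrite addSn addnS => pT.
apply: planar_ext (planar_contract (leq_addr m k) pT) => s sz.
have sT : size (take k s) = k by rewrite size_takel // sz leq_addr.
apply: eq_bigr => v _; apply: eq_bigr => w _.
rewrite -cat_rcons take_size_cat ?drop_size_cat ?size_rcons ?sT //.
by rewrite -cat_rcons cats1.
Qed.

End ListForm.

(** * Operations on the first variables, and their transport to other positions *)

Section FrontOperations.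
Variables (R : realType) (V : finType) (e : rel V).
Local Notation C := (R[i]).
Local Notation planar := (@planar R V e).

Lemma sum_delta (x : V) (f : V -> C) : \sum_v (x == v)%:R * f v = f x.
Proof.
rewrite (bigD1 x) //= eqxx mul1r big1 ?addr0 // => v /negPf.
by rewrite eq_sym => ->; rewrite mul0r.
Qed.

Definition planar2 (M : V -> V -> C) :=
  planar 2 (fun s => if s is [:: x; y] then M x y else 0).

Lemma codom2 (x : {ffun 'I_2 -> V}) : codom x = [:: x 0; x 1].
Proof.
apply: codom_seqP => // v0 i; case: i => [[|[|i]]] //= ilt; congr (x _); exact: val_inj.
Qed.

Lemma codom3 (x : {ffun 'I_3 -> V}) : codom x = [:: x 0; x 1; x 2].
Proof.
apply: codom_seqP => // v0 i; case: i => [[|[|[|i]]]] //= ilt; congr (x _); exact: val_inj.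
Qed.

Lemma planar2_delta : planar2 (fun x y => (x == y)%:R).
Proof. by apply: planar_of_gen (Gen_id _ _) _ => x; rewrite codom2 !ffunE. Qed.

Lemma planar2_adj : planar2 (fun x y => (e x y)%:R).
Proof. by apply: planar_of_gen (Gen_adj _ _) _ => x; rewrite codom2 !ffunE. Qed.

Lemma planar_ghz : planar 3 (fun s =>
  if s is [:: x; y; z] then ((x == y) && (y == z))%:R else 0).
Proof. by apply: planar_of_gen (Gen_ghz _ _) _ => x; rewrite codom3 !ffunE. Qed.

Lemma planar_one k : planar k (fun=> 1).
Proof.
elim: k => [|k IH]; first by apply: planar_of_gen (Gen_one0 _ _) _ => x; rewrite !ffunE.
have p1 : planar 1 (fun=> 1).
  by apply: planar_of_gen (Gen_one1 _ _) _ => x; rewrite !ffunE.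
by apply: planar_ext (planar_tensor p1 IH) => s _; rewrite mulr1.
Qed.

Lemma planar2_one : planar2 (fun _ _ => 1).
Proof. by apply: planar_ext (planar_one 2) => -[|x [|y []]]. Qed.

Lemma planar2_add M N :
  planar2 M -> planar2 N -> planar2 (fun x y => M x y + N x y).
Proof. by move=> pM pN; apply: planar_ext (planar_add pM pN) => -[|x [|y []]]. Qed.

Lemma planar2_scale a M : planar2 M -> planar2 (fun x y => a * M x y).
Proof. by move=> pM; apply: planar_ext (planar_scale a pM) => -[|x [|y []]]. Qed.

(** GHZ glued along one string splits the first variable into two equal ones. *)
Lemma planar_dup k F F' : planar k.+1 F ->
  (forall x y s, size s = k -> F' [:: x, y & s] = (x == y)%:R * F (x :: s)) ->
  planar k.+2 F'.
Proof.
move=> pF FF'; apply: planar_ext (planar_glue planar_ghz pF) => -[|x [|y s]] //= [sz].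
rewrite take0 drop0 FF' //=.
rewrite (eq_bigr (fun v => (y == v)%:R * ((x == y)%:R * F (v :: s)))) => [|v _].
  by rewrite sum_delta; case: eqP => [->|]; rewrite ?mul0r.
by rewrite -mulnb natrM mulrCA mulrA.
Qed.

(** GHZ glued along two strings restricts the first two variables to the diagonal. *)
Lemma planar_merge k F F' : planar k.+2 F ->
  (forall x s, size s = k -> F' (x :: s) = F [:: x, x & s]) -> planar k.+1 F'.
Proof.
move=> pF FF'; apply: planar_ext (planar_glue2 planar_ghz pF) => -[|x s] //= [sz].
rewrite take0 drop0 FF' //= -[RHS](sum_delta x (fun v => F [:: v, v & s])).
apply: eq_bigr => v _; rewrite -(sum_delta v (fun w => F [:: w, v & s])) mulr_sumr.
by apply: eq_bigr => w _; rewrite -mulnb natrM mulrA.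
Qed.

(** The first variable is capped with the constant 1 of one variable. *)
Lemma planar_sum_front k F : planar k.+1 F -> planar k (fun s => \sum_v F (v :: s)).
Proof.
move=> pF; apply: planar_ext (planar_glue (planar_one 1) pF) => s sz.
by apply: eq_bigr => v _; rewrite mul1r drop0.
Qed.

Lemma planar_act M k F F' : planar2 M -> planar k.+1 F ->
  (forall x s, size s = k -> F' (x :: s) = \sum_v M x v * F (v :: s)) ->
  planar k.+1 F'.
Proof.
move=> pM pF FF'; apply: planar_ext (planar_glue pM pF) => -[|x s] //= [sz].
by rewrite take0 drop0 FF'.
Qed.

(* T is glued along its first and last variables, which are duplicated. *)
Lemma planar_attach j k T F F' : planar j.+2 T -> planar k.+2 F ->
  (forall x y r s, size r = j -> size s = k ->
     F' (x :: r ++ y :: s) = T (x :: r ++ [:: y]) * F [:: x, y & s]) ->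
  planar (j.+2 + k) F'.
Proof.
move=> pT pF FF'.
pose T1 s := if s is x' :: x :: t then (x' == x)%:R * T (x' :: t) else 0.
have /(planar_rot1) p1: planar j.+3 T1 by apply: planar_dup pT _.
pose T3 s := if s is y :: y' :: t then (y == y')%:R * T1 (rot 1 (y :: t)) else 0.
have /(planar_rot) p3: planar j.+4 T3 by apply: planar_dup p1 _.
have lj : (j.+1 <= j.+4)%N by rewrite -addn3 leq_addr.
have := planar_glue2 (p3 j.+1 lj) pF.
apply: planar_ext => -[|x t] //=; rewrite addSn => -[sz].
have -> : t = take j t ++ drop j t by rewrite cat_take_drop.
have : size (take j t) = j by rewrite size_takel // sz addSn leqW ?leq_addr.
have : size (drop j t) = k.+1 by rewrite size_drop sz addSnnS addKn.
move: (take j t) (drop j t) => r [|y s] // [ss] sr; rewrite FF' //.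
have -> : take j.+1 (r ++ y :: s) = rcons r y.
  by rewrite -cat_rcons take_size_cat // size_rcons sr.
have -> : drop j.+1 (r ++ y :: s) = s.
  by rewrite -cat_rcons drop_size_cat // size_rcons sr.
rewrite -(sum_delta y (fun v => T (x :: r ++ [:: y]) * F [:: x, v & s])).
apply: eq_bigr => v _.
rewrite -(sum_delta x (fun w => T (x :: r ++ [:: y]) * F [:: w, v & s])) mulr_sumr.
apply: eq_bigr => w _.
rewrite cat_rcons -[x :: _]/((x :: r) ++ [:: y; v; w]).
have -> : j.+1 = size (x :: r) by rewrite /= sr.
rewrite rot_size_cat /= (eq_sym w).
by case: (x =P w) => [<-|_]; rewrite ?mul0r ?mulr0 ?mul0r ?mul1r ?mulrA.
Qed.

Lemma planar_mul M k F F' : planar2 M -> planar k.+2 F ->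
  (forall x y s, size s = k -> F' [:: x, y & s] = M x y * F [:: x, y & s]) ->
  planar k.+2 F'.
Proof. by move=> pM pF FF'; apply: planar_attach pM pF _ => x y [|//] s _ /= /FF'. Qed.

(* For M = 1, the value is that of the crossing of two strings. *)
Definition planar_crossing (M : V -> V -> C) :=
  planar 4 (fun s => if s is [:: x; y; v; w] then
                       M x y * ((x == v) && (y == w))%:R else 0).

Lemma planar_swap M k F F' : planar_crossing M -> planar k.+2 F ->
  (forall x y s, size s = k -> F' [:: x, y & s] = M x y * F [:: y, x & s]) ->
  planar k.+2 F'.
Proof.
move=> pM pF FF'; apply: planar_ext (planar_glue2 pM pF) => -[|x [|y s]] //= [sz].
rewrite take0 drop0 FF' //= -[RHS](sum_delta x (fun v => M x y * F [:: y, v & s])).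
apply: eq_bigr => v _; rewrite -(sum_delta y (fun w => M x y * F [:: w, v & s])) mulr_sumr.
apply: eq_bigr => w _.
by rewrite -mulnb natrM [M x y * _]mulrC !mulrA.
Qed.

(** A rotation brings the pair to the front, where [planar_swap] applies; a second rotation restores
    the positions. *)
Lemma planar_swap_at M i j F F' : planar_crossing M -> planar (i + j.+2) F ->
  (forall s1 x y s2, size s1 = i -> size s2 = j ->
     F' (s1 ++ [:: x, y & s2]) = M x y * F (s1 ++ [:: y, x & s2])) ->
  planar (i + j.+2) F'.
Proof.
move=> pM pF FF'.
have := planar_rot (leq_addl i j.+2) pF; rewrite {1}addnC => p0.
pose F1 s := if s is [:: x, y & t] then M x y * F (rot j.+2 [:: y, x & t]) else 0.
have p1 : planar (j.+2 + i) F1 by apply: (planar_swap pM p0).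
have := planar_rot (leq_addl j.+2 i) p1; rewrite {1}addnC.
apply: planar_ext => s sz.
rewrite -(cat_take_drop i s).
have : size (take i s) = i by rewrite size_takel // sz leq_addr.
have : size (drop i s) = j.+2 by rewrite size_drop sz addKn.
move: (take i s) (drop i s) => s1 [|x [|y s2]] // [s2j] s1i.
rewrite FF' // -{1}s1i rot_size_cat /= -[_ :: _ :: _]/([:: y, x & s2] ++ s1).
by rewrite (_ : j.+2 = size [:: y, x & s2]) ?rot_size_cat //= s2j.
Qed.

Lemma planar_merge_at i j F F' : planar (i + j.+2) F ->
  (forall s1 x s2, size s1 = i -> size s2 = j ->
     F' (s1 ++ x :: s2) = F (s1 ++ [:: x, x & s2])) ->
  planar (i + j.+1) F'.
Proof.
move=> pF FF'.
have := planar_rot (leq_addl i j.+2) pF; rewrite {1}addnC => p0.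
pose F1 s := if s is x :: t then F (rot j.+2 [:: x, x & t]) else 0.
have p1 : planar (j.+1 + i) F1 by apply: (planar_merge p0).
have := planar_rot (leq_addl j.+1 i) p1; rewrite {1}addnC.
apply: planar_ext => s sz.
rewrite -(cat_take_drop i s).
have : size (take i s) = i by rewrite size_takel // sz leq_addr.
have : size (drop i s) = j.+1 by rewrite size_drop sz addKn.
move: (take i s) (drop i s) => s1 [|x s2] // [s2j] s1i.
rewrite FF' // -{1}s1i rot_size_cat /= -[_ :: _ :: _]/([:: x, x & s2] ++ s1).
by rewrite (_ : j.+2 = size [:: x, x & s2]) ?rot_size_cat //= s2j.
Qed.

End FrontOperations.

(** * Consequences of a planar crossing: arbitrary substitution of variables *)

Section Symmetric.
Variables (R : realType) (V : finType) (e : rel V) (v0 : V).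
Local Notation C := (R[i]).
Local Notation planar := (@planar R V e).
Hypothesis crossing : planar_crossing e (fun _ _ => 1 : C).

Definition to_front i (s : seq V) :=
  if drop i s is x :: t then x :: take i s ++ t else s.

Lemma to_front_cat s1 x s2 : to_front (size s1) (s1 ++ x :: s2) = x :: s1 ++ s2.
Proof. by rewrite /to_front drop_size_cat // take_size_cat. Qed.

(** By induction on [i]: one crossing of the variables at [i] and [i.+1] reduces [to_front i.+1] to
    [to_front i]. *)
Lemma planar_to_front k i F : (i <= k)%N -> planar k.+1 F ->
  planar k.+1 (fun s => F (to_front i s)).
Proof.
move=> + pF; elim: i => [|i IH] ik.
  apply: planar_ext pF => -[|x s] //= _.
have kE : k.+1 = (i + (k - i.+1).+2)%N by rewrite !addnS -addSn subnKC.
move: (IH (ltnW ik)); rewrite kE => pG; apply: (planar_swap_at crossing pG).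
move=> s1 x y s2 s1i s2j; rewrite mul1r -s1i to_front_cat.
by rewrite -(size_rcons s1 x) -cat_rcons to_front_cat cat_rcons.
Qed.

(** The first variable of [F] is moved next to the one it has to equal, and the two are merged. *)
Lemma planar_subst1 k i F : (i < k)%N -> planar k.+1 F ->
  planar k (fun s => F (nth v0 s i :: s)).
Proof.
move=> ik /(planar_to_front (ltnW ik)).
have kE : k.+1 = (i + (k - i.+1).+2)%N by rewrite !addnS -addSn subnKC.
have kE' : k = (i + (k - i.+1).+1)%N by rewrite !addnS -addSn subnKC.
rewrite kE {2}kE'=> pG; apply: (planar_merge_at pG) => s1 x s2 s1i s2j.
by rewrite nth_cat s1i ltnn subnn -s1i to_front_cat.
Qed.

Lemma planar_subst_cat k (a : seq nat) F : all (ltn^~ k) a ->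
  planar (size a + k) F -> planar k (fun s => F ([seq nth v0 s i | i <- a] ++ s)).
Proof.
elim: a F => [//|i a IH] F /= /andP[ik ak] pF.
have ik' : (size a + i < size a + k)%N by rewrite ltn_add2l.
apply: planar_ext (IH _ ak (planar_subst1 ik' pF)) => s _.
by rewrite nth_cat size_map ltnNge leq_addr addKn.
Qed.

(** [F] is tensored with the constant 1 of [k] variables, and each variable of [F] is then
    identified with one of these. The list [a] may permute, repeat or omit indices. *)
Lemma planar_subst k (a : seq nat) F : all (ltn^~ k) a ->
  planar (size a) F -> planar k (fun s => F [seq nth v0 s i | i <- a]).
Proof.
move=> ak pF; have := planar_subst_cat ak (planar_tensor pF (planar_one R e k)).
apply: planar_ext => s _; rewrite mulr1 take_size_cat ?size_map //.
Qed.

Lemma planar_pointwise_mul k F G :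
  planar k F -> planar k G -> planar k (fun s => F s * G s).
Proof.
move=> pF pG; have := planar_tensor pF pG.
pose a := iota 0 k ++ iota 0 k.
have <- : size a = (k + k)%N by rewrite size_cat size_iota.
have ak : all (ltn^~ k) a.
  by rewrite all_cat; apply/andP; split; apply/allP => i; rewrite mem_iota.
move/(planar_subst ak); apply: planar_ext => s sz.
rewrite map_cat take_size_cat ?size_map ?size_iota // drop_size_cat ?size_map ?size_iota //.
by rewrite -sz map_nth_iota0 // take_size.
Qed.

Lemma planar_prod k (I : finType) (F : I -> seq V -> C) :
  (forall i, planar k (F i)) -> planar k (fun s => \prod_i F i s).
Proof.
move=> pF; rewrite /index_enum; elim: (Finite.enum I) => [|i r IH].
  by apply: planar_ext (planar_one R e k) => s _; rewrite big_nil.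
by apply: planar_ext (planar_pointwise_mul (pF i) IH) => s _; rewrite big_cons.
Qed.

Lemma planar_pair k (i j : 'I_k) M : planar2 e M ->
  planar k (fun s => M (nth v0 s i) (nth v0 s j)).
Proof.
move=> pM; have ak : all (ltn^~ k) [:: val i; val j] by rewrite /= !ltn_ord.
exact: planar_ext (planar_subst ak pM).
Qed.

Lemma planar_sum_tuple m k F : planar (m + k) F ->
  planar k (fun s => \sum_(t : m.-tuple V) F (t ++ s)).
Proof.
elim: m F => [|m IH] F pF.
  apply: planar_ext pF => s _; rewrite (big_pred1 [tuple]) // => t.
  by rewrite [t]tuple0 /= eqxx.
apply: planar_ext (IH _ (planar_sum_front pF)) => s _.
rewrite exchange_big pair_big /=.
rewrite [RHS](reindex (fun p : V * m.-tuple V => [tuple of p.1 :: p.2])) //=.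
exists (fun t => (thead t, [tuple of behead t])) => [[v t] _|t _] /=.
  by rewrite theadE; congr pair; apply: val_inj.
by rewrite -tuple_eta.
Qed.

End Symmetric.

(** * Planar elements are invariant *)

Section Invariance.
Variables (R : realType) (V : finType) (e : rel V).
Local Notation C := (R[i]).

(** The generators depend only on equality and adjacency, which automorphisms preserve, and every
    planar operation commutes with the action; for a contraction the summed vertex is reindexed by
    [s^-1]. *)
Lemma aut_invariant_of_planar_gen k (f : spin_space R V k) :
  planar_gen e f -> aut_invariant e f.
Proof.
move=> pf s sA; have es x y : e ((s^-1)%g x) ((s^-1)%g y) = e x y.
  move: sA; rewrite inE => /forallP/(_ ((s^-1)%g x))/forallP/(_ ((s^-1)%g y)).
  by rewrite !permKV => /eqP.
elim: {k f} pf => [||||||k f g _ IHf _ IHg|k a f _ IH|k m f g _ IHf _ IHg|k i f _ IH|k f _ IH].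
- by apply/ffunP => x; rewrite !ffunE.
- by apply/ffunP => x; rewrite !ffunE.
- by apply/ffunP => x; rewrite !ffunE (inj_eq perm_inj).
- by apply/ffunP => x; rewrite !ffunE !(inj_eq perm_inj).
- by apply/ffunP => x; rewrite !ffunE es.
- by move=> k; apply/ffunP => x; rewrite !ffunE.
- by rewrite -{2}IHf -{2}IHg; apply/ffunP => x; rewrite !ffunE.
- by rewrite -{2}IH; apply/ffunP => x; rewrite !ffunE.
- rewrite -{2}IHf -{2}IHg; apply/ffunP => x; rewrite !ffunE.
  by congr (f _ * g _); apply/ffunP => i; rewrite !ffunE.
- rewrite -{2}IH; apply/ffunP => x; rewrite !ffunE (reindex_inj (@perm_inj _ (s^-1)%g)) /=.
  apply: eq_bigr => v _; rewrite !ffunE; congr (f _); apply/ffunP => j.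
  rewrite !ffunE; case: unliftP => // j' _.
  by rewrite !ffunE; case: unliftP => // j'' _; rewrite ffunE.
- rewrite -{2}IH; apply/ffunP => x; rewrite !ffunE.
  by congr (f _); apply/ffunP => i; rewrite !ffunE.
Qed.

End Invariance.

(** * Invariant functions are planar once the crossing is *)

Section PropertyG.
Variables (R : realType) (V : finType) (e : rel V) (v0 : V).
Local Notation C := (R[i]).
Local Notation planar := (@planar R V e).
Local Notation planar2 := (@planar2 R V e).
Hypothesis crossing : planar_crossing e (fun _ _ => 1 : C).

Lemma natr_forall (I : finType) (b : pred I) :
  [forall i, b i]%:R = \prod_i (b i)%:R :> C.
Proof.
have -> : [forall i, b i] = \big[andb/true]_i b i by rewrite big_andE; apply: eq_forallb.
by rewrite (big_morph (fun c : bool => c%:R : C) (id1 := 1) (op1 := *%R)) //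
  => x y; rewrite -mulnb natrM.
Qed.

Lemma planar2_eqb (c : bool) (b : rel V) : planar2 (fun x y => (b x y)%:R) ->
  planar2 (fun x y => (b x y == c)%:R).
Proof.
case: c => pb; first by apply: planar_ext pb => -[|x [|y []]] //= _; rewrite eqb_id.
apply: planar_ext (planar2_add (planar2_one R e) (planar2_scale (-1) pb)).
by move=> -[|x [|y []]] //= _; rewrite eqbF_neg mulN1r; case: (b x y); rewrite ?subrr ?subr0.
Qed.

(** The quantifier-free type of a list: its pattern of equalities and adjacencies. When both lists
    have length [N], the default [v0] is never read. *)
Definition same_type N (t u : seq V) := [forall i : 'I_N, forall j : 'I_N,
  ((nth v0 u i == nth v0 u j) == (nth v0 t i == nth v0 t j))
  && (e (nth v0 u i) (nth v0 u j) == e (nth v0 t i) (nth v0 t j))].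

Lemma planar_same_type N t : planar N (fun u => (same_type N t u)%:R).
Proof.
have p1 : planar N (fun u => \prod_(i < N) \prod_(j < N)
   (((nth v0 u i == nth v0 u j) == (nth v0 t i == nth v0 t j))%:R *
    (e (nth v0 u i) (nth v0 u j) == e (nth v0 t i) (nth v0 t j))%:R)).
  apply: (planar_prod v0) => // i; apply: (planar_prod v0) => // j.
  apply: (planar_pointwise_mul v0) => //.
  - exact: (planar_pair v0 crossing i j (planar2_eqb _ (planar2_delta R e))).
  - exact: (planar_pair v0 crossing i j (planar2_eqb _ (planar2_adj R e))).
apply: planar_ext p1 => u _; rewrite /same_type natr_forall; apply: eq_bigr => i _.
by rewrite natr_forall; apply: eq_bigr => j _; rewrite -natrM mulnb.
Qed.

Lemma same_type_catl m k (E t y z : seq V) : size E = m -> size t = m ->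
  same_type (m + k) (E ++ y) (t ++ z) -> same_type m E t.
Proof.
move=> sE st /forallP H; apply/forallP => i; apply/forallP => j.
have /forallP/(_ (lshift k j)) := H (lshift k i).
by rewrite !nth_cat sE st /= !ltn_ord.
Qed.

(** Sending the i-th vertex of [enum V] to the i-th entry of [t] is injective by the equality
    pattern and an automorphism by the adjacency pattern. *)
Lemma same_type_enumP (t : seq V) : size t = #|V| -> same_type #|V| (enum V) t ->
  exists2 s : {perm V}, s \in graph_aut e & t = map s (enum V).
Proof.
move=> st /forallP H.
have sE : size (enum V) = #|V| by rewrite cardE.
pose sg v := nth v0 t (index v (enum V)).
have rk v : (index v (enum V) < #|V|)%N by rewrite -sE index_mem mem_enum.
have nE v : nth v0 (enum V) (index v (enum V)) = v by rewrite nth_index ?mem_enum.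
have K x y : ((sg x == sg y) == (x == y)) && (e (sg x) (sg y) == e x y).
  by have /forallP/(_ (Ordinal (rk y))) := H (Ordinal (rk x)); rewrite /= !nE.
have sgI : injective sg.
  by move=> x y /eqP; have /andP[/eqP -> _] := K x y => /eqP.
exists (perm sgI).
  by rewrite inE; apply/forallP => x; apply/forallP => y; rewrite !permE; case/andP: (K x y).
apply: (@eq_from_nth _ v0) => [|i]; first by rewrite size_map st cardE.
rewrite st => iV.
rewrite (nth_map v0) ?sE // permE /sg index_uniq ?enum_uniq //.
by rewrite sE.
Qed.

(** Each entry of [y] also occurs in [enum V], so the equality pattern alone determines the
    corresponding entry of [z]. *)
Lemma same_type_map (s : {perm V}) k (y z : seq V) : s \in graph_aut e ->
  size y = k -> size z = k ->
  same_type (#|V| + k) (enum V ++ y) (map s (enum V) ++ z) = (z == map s y).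
Proof.
rewrite inE => /forallP es sy sz; have sE : size (enum V) = #|V| by rewrite cardE.
apply/idP/eqP => [/forallP H|->].
  apply: (@eq_from_nth _ v0); rewrite ?size_map ?sy // => i; rewrite sz => ik.
  rewrite (nth_map v0) ?sy //; set v := nth v0 y i.
  have rk : (index v (enum V) < #|V|)%N by rewrite -sE index_mem mem_enum.
  have /forallP/(_ (rshift _ (Ordinal ik))) := H (lshift k (Ordinal rk)).
  have sM : size (map s (enum V)) = #|V| by rewrite size_map -cardE.
  rewrite !nth_cat sM sE /= rk ltnNge leq_addr /= addKn (nth_map v0) ?sE //.
  by rewrite nth_index ?mem_enum // eqxx => /andP[/eqP/eqP/esym].
rewrite -map_cat; apply/forallP => i; apply/forallP => j.
have lt (l : 'I_(#|V| + k)) : (l < size (enum V ++ y))%N by rewrite size_cat sE sy.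
rewrite !(nth_map v0) // (inj_eq perm_inj) eqxx /=.
by have /forallP := es (nth v0 (enum V ++ y) i); apply.
Qed.

(* A list t + z of the same type as (enum V) + y is its image under a unique
   automorphism s, so that the sum over y of f(y) times the indicator of this
   condition is f(z) or 0, according to whether t is the image of enum V under
   an automorphism; the sum over t is thus a nonzero multiple of f(z). *)
Lemma planar_of_invariant k (F : seq V -> C) :
  (forall (s : {perm V}) y, s \in graph_aut e -> size y = k -> F (map s y) = F y) ->
  planar k F.
Proof.
move=> Finv.
pose G u := \sum_(y : k.-tuple V) F y * (same_type (#|V| + k) (enum V ++ y) u)%:R.
have pG : planar (#|V| + k) G.
  by apply: planar_sum => y; apply: planar_scale; apply: planar_same_type.
pose n0 := #|[pred t : #|V|.-tuple V | same_type #|V| (enum V) t]|.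
have n0_neq0 : n0%:R != 0 :> C.
  rewrite pnatr_eq0 -lt0n; apply/card_gt0P.
  have sE : size (enum V) == #|V| by rewrite cardE.
  exists (Tuple sE); rewrite inE /=; apply/forallP => i; apply/forallP => j.
  by rewrite !eqxx.
apply: planar_ext (planar_scale n0%:R^-1 (planar_sum_tuple pG)) => z sz.
apply: (canLR (mulKf n0_neq0)).
have -> : n0%:R = \sum_(t : #|V|.-tuple V) (same_type #|V| (enum V) t)%:R :> C.
  rewrite /n0 -[#|_|]sum1_card natr_sum big_mkcond /=; apply: eq_bigr => t _.
  by rewrite inE; case: same_type.
rewrite mulr_suml; apply: eq_bigr => t _; rewrite /G.
case: (boolP (same_type #|V| _ _)) => [/same_type_enumP|/negP nst]; last first.
  rewrite mul0r big1 // => y _; case: (boolP (same_type _ _ _)) => [|_]; last by rewrite mulr0.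
  by move/same_type_catl => H; case: nst; apply: H; rewrite ?size_tuple // cardE.
rewrite size_tuple => /(_ erefl)[s sA ->]; rewrite mul1r.
have [y0 y0E] : exists y0 : k.-tuple V, map s y0 = z.
  have sz' : size (map (s^-1)%g z) == k by rewrite size_map sz.
  by exists (Tuple sz'); rewrite -map_comp map_id_in // => v _; rewrite /= permKV.
rewrite (bigD1 y0) //= same_type_map ?size_tuple // y0E eqxx mulr1 big1 ?addr0.
  by rewrite -[in RHS]y0E (Finv s) // size_tuple.
move=> y /negP yy0; rewrite same_type_map ?size_tuple // -y0E.
case: eqP => [yE|_]; last by rewrite mulr0.
by case: yy0; apply/eqP/val_inj/esym/(inj_map perm_inj yE).
Qed.

Theorem property_G_of_crossing : property_G R e.
Proof.
move=> k f; split; first exact: aut_invariant_of_planar_gen.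
move=> finv; pose F (s : seq V) : C := f [ffun i : 'I_k => nth v0 s i].
have pF : planar k F.
  apply: planar_of_invariant => s y sA sy; rewrite /F -{1}(finv s sA) !ffunE.
  congr (f _); apply/ffunP => i; by rewrite !ffunE (nth_map v0) ?sy // permK.
move: pF; rewrite /planar; congr planar_gen; apply/ffunP => x.
rewrite ffunE /F; congr (f _); apply/ffunP => i.
by rewrite ffunE nth_codom_ffun.
Qed.

End PropertyG.

(** * Counting with 2-subsets *)

Section KneserCombinatorics.
Local Open Scope nat_scope.
Variable n : nat.
Local Notation V := (kneser_vertex n).
Implicit Types a b c v w : V.

Definition vertex (B : {set 'I_n}) (B2 : #|B| == 2) : V := exist _ B B2.

Definition meet_in_one a b := #|val a :&: val b| == 1%N.

Lemma card_vertex a : #|val a| = 2. Proof. exact/eqP/(valP a). Qed.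

Lemma kneser_adjE a b : kneser_adj a b = (#|val a :&: val b| == 0%N).
Proof. by rewrite /kneser_adj -setI_eq0 cards_eq0. Qed.

Lemma card_meet2 a b : (#|val a :&: val b| == 2) = (a == b).
Proof.
apply/eqP/eqP => [ab|->]; last by rewrite setIid card_vertex.
apply: val_inj; transitivity (val a :&: val b); last first.
  by apply/eqP; rewrite eqEcard subsetIr ab card_vertex.
by apply/esym/eqP; rewrite eqEcard subsetIl ab card_vertex.
Qed.

(** Two 2-subsets share 2, 1 or 0 points. Stated as a sum, this becomes a decomposition of the
    constant 1 over the complex numbers. *)
Lemma meet_cases a b :
  ((a == b) + meet_in_one a b + kneser_adj a b = 1)%N.
Proof.
rewrite kneser_adjE /meet_in_one -card_meet2.
have := subset_leq_card (subsetIl (val a) (val b)); rewrite card_vertex.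
by case: #|_| => [|[|[|]]].
Qed.

Definition triangle a b c := [forall x, (x \in val c) == (x \in val a) (+) (x \in val b)].

Lemma triangleP a b c :
  reflect (forall x, (x \in val c) = (x \in val a) (+) (x \in val b)) (triangle a b c).
Proof. exact: 'forall_eqP. Qed.

Lemma triangleC a b c : triangle a b c = triangle b a c.
Proof. by apply: eq_forallb => x; rewrite addbC. Qed.

Lemma triangle_rot a b c : triangle a b c = triangle b c a.
Proof.
apply: eq_forallb => x.
by case: (x \in val a); case: (x \in val b); case: (x \in val c).
Qed.

Lemma triangleAC a b c : triangle a b c = triangle a c b.
Proof. by rewrite triangleC triangle_rot. Qed.

Lemma triangle_inj a b v w : triangle a b v -> triangle a b w -> v = w.
Proof.
by move=> /triangleP av /triangleP aw; apply/val_inj/setP => x; rewrite av aw.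
Qed.

Definition symdiff (A B : {set 'I_n}) := (A :\: B) :|: (B :\: A).

Lemma in_symdiff A B x : (x \in symdiff A B) = (x \in A) (+) (x \in B).
Proof. by rewrite !inE; case: (x \in A); case: (x \in B). Qed.

Lemma triangleE a b c : triangle a b c = (val c == symdiff (val a) (val b)).
Proof.
by apply/triangleP/eqP => [cE|-> x]; [apply/setP => x; rewrite cE|]; rewrite in_symdiff.
Qed.

Lemma card_symdiff a b : (#|symdiff (val a) (val b)| + 2 * #|val a :&: val b| = 4)%N.
Proof.
have := cardsID (val b) (val a); have := cardsID (val a) (val b).
rewrite !card_vertex cardsU setIC [_ :&: (_ :\: _)](_ : _ = set0); last first.
  by apply/setP => x; rewrite !inE; case: (x \in val a); case: (x \in val b).
by rewrite cards0 subn0; lia.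
Qed.

(** The only possible third side is the symmetric difference, which by [card_symdiff] has two
    elements exactly when [a] and [b] share one point. The boolean is read as 0 or 1. *)
Lemma card_triangle a b : #|[pred v | triangle a b v]| = meet_in_one a b.
Proof.
have := card_symdiff a b; rewrite /meet_in_one; case: eqP => [-> | ab] sd.
  have sd2 : #|symdiff (val a) (val b)| == 2 by lia.
  rewrite (@eq_card1 _ (vertex sd2)) // => v.
  by rewrite !inE triangleE -val_eqE.
apply: eq_card0 => v; rewrite !inE triangleE; apply/negP => /eqP vE.
by move: sd; rewrite -vE card_vertex; lia.
Qed.

Lemma triangle_meet a b c : triangle a b c -> meet_in_one a b.
Proof.
by rewrite -[meet_in_one a b]lt0b -card_triangle => abc; apply/card_gt0P; exists c.
Qed.

(** The common neighbours are the 2-subsets of the complement of the union. *)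
Lemma card_common_nbr a b c :
  #|[pred v | [&& kneser_adj a v, kneser_adj b v & kneser_adj c v]]| =
  'C(n - #|val a :|: val b :|: val c|, 2).
Proof.
set U := _ :|: _.
have -> : (n - #|U| = #|~: U|)%N by rewrite [RHS]cardsCs setCK card_ord.
rewrite -cards_draws -cardsE -(card_imset _ val_inj).
have kneserE v : [&& kneser_adj a v, kneser_adj b v & kneser_adj c v] = (val v \subset ~: U).
  rewrite /kneser_adj ![[disjoint _ & val v]]disjoint_sym !disjoints_subset.
  by rewrite /U !setCU !subsetI andbA.
congr #|pred_of_set _|; apply/setP => B; rewrite !inE.
apply/imsetP/andP => [[v + ->]|[BU B2]].
  by rewrite !inE kneserE card_vertex.
by exists (vertex B2) => //; rewrite inE kneserE.
Qed.

(** By inclusion-exclusion the union has 3 + t points, where t is the size of the triple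
    intersection: t = 0 for a triangle, t = 1 for a star. *)
Lemma card_union_triangle a b c :
  meet_in_one a b -> meet_in_one b c -> meet_in_one c a ->
  #|val a :|: val b :|: val c| = if triangle a b c then 3 else 4.
Proof.
move=> /eqP ab /eqP bc /eqP ca; have sd := card_symdiff a b.
have := subset_leq_card (subsetIl (val a :&: val b) (val c)); rewrite ab => t1.
have Uab : #|val a :|: val b| = 3 by rewrite cardsU !card_vertex ab.
have Uc : (#|(val a :|: val b) :&: val c| + #|val a :&: val b :&: val c| = 2)%N.
  by rewrite setIUl cardsU [val a :&: val c]setIC ca bc (setIC (val c)) -setIIl; lia.
rewrite cardsU Uab card_vertex.
suff -> : triangle a b c = (#|val a :&: val b :&: val c| == 0%N) by case: eqP; lia.
apply/idP/eqP => [/triangleP tr|t0].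
  apply/eqP; rewrite cards_eq0; apply/eqP/setP => x; rewrite !inE tr.
  by case: (x \in val a); case: (x \in val b).
rewrite triangleE eqEcard card_vertex; apply/andP; split; last by lia.
have cU : val c \subset val a :|: val b.
  apply/setIidPr/eqP; rewrite eqEcard subsetIr card_vertex; lia.
apply/subsetP => x xc; have := subsetP cU x xc.
have : x \notin val a :&: val b :&: val c.
  by move/eqP: t0; rewrite cards_eq0 => /eqP->; rewrite inE.
rewrite !inE xc; by case: (x \in val a); case: (x \in val b).
Qed.

(** Such a [v] consists of one point of [a] and one of [b], which gives 2 * 2 choices as [a] and [b]
    are disjoint. *)
Lemma card_meet_both a b : kneser_adj a b ->
  #|[pred v | meet_in_one v a && meet_in_one v b]| = 4.
Proof.
move=> dab.
have nab x : x \in val a -> x \in val b -> False.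
  by move=> xa xb; move/pred0P/(_ x): dab; rewrite /= xa xb.
rewrite -cardsE -(card_imset _ val_inj).
rewrite (_ : _ @: _ = [set [set p.1; p.2] | p in setX (val a) (val b)]).
  rewrite card_in_imset ?cardsX ?card_vertex // => -[i j] [k l].
  rewrite !inE /= => /andP[ia jb] /andP[ka lb] E.
  have ik : i == k.
    have : i \in [set k; l] by rewrite -E !inE eqxx.
    by rewrite !inE => /orP[//|/eqP il]; case: (nab i); rewrite // il.
  have jl : j == l.
    have : j \in [set k; l] by rewrite -E !inE eqxx orbT.
    by rewrite !inE => /orP[/eqP jk|//]; case: (nab j); rewrite // jk.
  by rewrite (eqP ik) (eqP jl).
apply/setP => B; apply/imsetP/imsetP => [[v + ->]|[[i j] + ->]].
  rewrite !inE => /andP[/cards1P[i vi] /cards1P[j vj]].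
  have /setIP[iv ia] : i \in val v :&: val a by rewrite vi inE.
  have /setIP[jv jb] : j \in val v :&: val b by rewrite vj inE.
  exists (i, j); first by rewrite inE ia jb.
  apply/esym/eqP; rewrite eqEcard card_vertex cards2 subUset !sub1set iv jv /=.
  by case: eqP => // ij; case: (nab i); rewrite // ij.
rewrite !inE /= => /andP[ia jb].
have ij : i != j by apply/eqP => ij; case: (nab i); rewrite // ij.
have ij2 : #|[set i; j]| == 2 by rewrite cards2 ij.
exists (vertex ij2) => //; rewrite inE /meet_in_one /=; apply/andP; split.
  apply/cards1P; exists i; apply/setP => x; rewrite !inE.
  case: (x =P i) => [->|_] //=; case: (x =P j) => [->|//] /=.
  by apply/negP => /nab; apply.
apply/cards1P; exists j; apply/setP => x; rewrite !inE.
case: (x =P j) => [->|_] //=; first by rewrite orbT.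
by rewrite orbF; case: (x =P i) => [->|//] /=; apply/negP => /(nab _ ia).
Qed.

(** Since v + w = b is disjoint from [a], the edges [v] and [w] have the same trace on [a]. *)
Lemma triangle_meet_transfer a b v w :
  kneser_adj a b -> triangle v w b -> meet_in_one w a = meet_in_one v a.
Proof.
move=> /pred0P dab /triangleP tr; rewrite /meet_in_one; congr (#|pred_of_set _| == _).
apply/setP => x; have := dab x; rewrite !inE /= tr.
by case: (x \in val a); case: (x \in val v); case: (x \in val w).
Qed.

End KneserCombinatorics.

(** * Functions of three variables, and the crossing of equal vertices *)

Section Planar3.
Variables (R : realType) (V : finType) (e : rel V).
Local Notation C := (R[i]).

Definition planar3 (F : V -> V -> V -> C) :=
  planar e 3 (fun s => if s is [:: x; y; z] then F x y z else 0).

Lemma planar3_rot F : planar3 F -> planar3 (fun x y z => F y z x).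
Proof. by move=> pF; apply: planar_ext (planar_rot1 pF) => -[|x [|y [|z []]]]. Qed.

Lemma planar3_mul M F :
  planar2 e M -> planar3 F -> planar3 (fun x y z => M x y * F x y z).
Proof. by move=> pM pF; apply: (planar_mul pM pF) => x y [|z []]. Qed.

Lemma planar3_act M F : planar2 e M -> planar3 F ->
  planar3 (fun x y z => \sum_v M x v * F v y z).
Proof. by move=> pM pF; apply: (planar_act pM pF) => x [|y [|z []]]. Qed.

(** When x = y, all four variables coincide, so this is GHZ with one variable duplicated. *)
Lemma planar_crossing_delta : planar_crossing e (fun x y => (x == y)%:R : C).
Proof.
apply: (planar_dup (planar_ghz R e)) => x y [|v [|w []]] //= _.
rewrite -!natrM !mulnb; congr (_%:R); congr nat_of_bool.
by case: eqP => [<-|] //=; case: eqP => [<-|].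
Qed.

End Planar3.

(** * The triangle relation and the crossing are planar for the Kneser graph *)

Section KneserCrossing.
Variables (R : realType) (n : nat).
Local Notation V := (kneser_vertex n).
Local Notation C := (R[i]).
Local Notation e := (@kneser_adj n).
Local Notation planar := (@planar R V e).

Lemma natr_sum_card (b : pred V) : \sum_v (b v)%:R = #|b|%:R :> C.
Proof.
rewrite -sum1_card natr_sum [RHS]big_mkcond; apply: eq_bigr => v _.
by rewrite unfold_in; case: (b v).
Qed.

(** By [meet_cases] this is 1 minus the identity minus the adjacency matrix. *)
Lemma planar2_meet : planar2 e (fun a b : V => (meet_in_one a b)%:R : C).
Proof.
apply: planar_ext (planar2_add (planar2_one R e)
  (planar2_scale (-1) (planar2_add (planar2_delta R e) (planar2_adj R e)))).
move=> -[|a [|b []]] //= _; rewrite mulN1r.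
have : (a == b)%:R + (meet_in_one a b)%:R + (kneser_adj a b)%:R = 1 :> C.
  by rewrite -!natrD meet_cases.
move: ((a == b)%:R : C) ((meet_in_one a b)%:R : C) ((kneser_adj a b)%:R : C) => x z y <-.
by ring.
Qed.

Lemma planar3_triangle (hn : (5 <= n)%N) :
  planar3 e (fun a b c : V => (triangle a b c)%:R : C).
Proof.
have pA := planar2_adj R e; have pL := planar2_meet.
(* Both operations end with a rotation, so three applications treat each variable, or each cyclic
   pair, once. *)
have act F (pF : planar3 e F) := planar3_rot (planar3_act pA pF).
have mul F (pF : planar3 e F) := planar3_rot (planar3_mul pL pF).
pose L3 (a b c : V) := [&& meet_in_one a b, meet_in_one b c & meet_in_one c a].
have pL3 : planar3 e (fun a b c : V => (L3 a b c)%:R : C).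
  have p1 : planar3 e (fun _ _ _ : V => 1 : C).
    by apply: planar_ext (planar_one R e 3) => -[|x [|y [|z []]]].
  apply: planar_ext (mul _ (mul _ (mul _ p1))) => -[|x [|y [|z []]]] //= _.
  by rewrite mulr1 -!natrM !mulnb /L3 andbA andbC andbA.
pose N (a b c : V) : nat :=
  #|[pred v | [&& kneser_adj a v, kneser_adj b v & kneser_adj c v]]|.
(* The adjacency matrix on each leg of GHZ sums over one vertex [v] adjacent to [a], [b] and [c]. *)
have pN : planar3 e (fun a b c : V => (N a b c)%:R : C).
  have pG : planar3 e (fun a b c : V => ((a == b) && (b == c))%:R : C) := planar_ghz R e.
  apply: planar_ext (act _ (act _ (act _ pG))) => -[|a [|b [|c []]]] //= _.
  rewrite -natr_sum_card; apply: eq_bigr => v _.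
  rewrite (eq_bigr (fun u => (v == u)%:R * ((e c u)%:R * (e a v)%:R))) => [|u _].
    by rewrite sum_delta -!natrM !mulnb /=; case: (e a v) (e b v) (e c v) => [] [] [].
  rewrite (eq_bigr (fun t => (v == t)%:R * ((v == u)%:R * (e a t)%:R))) => [|t _].
    by rewrite sum_delta mulrCA.
  by rewrite -mulnb natrM mulrC mulrA eq_sym.
have pLN : planar3 e (fun a b c : V => (L3 a b c)%:R * (N a b c)%:R : C).
  apply: planar_ext (mul _ (mul _ (mul _ pN))) => -[|x [|y [|z []]]] //= _.
  by rewrite /L3 -!mulnb !natrM; rewrite !mulrA; congr (_ * _); rewrite mulrC mulrA.
(* On pairwise meeting triples, [N] is 'C(n - 3, 2) for a triangle and 'C(n - 4, 2) for a star. The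
   difference is n - 4, nonzero because n is at least 5. *)
have n4 : (n - 4)%:R != 0 :> C by rewrite pnatr_eq0; lia.
apply: planar_ext (planar_scale (n - 4)%:R^-1 (planar_add pLN
   (planar_scale (- 'C(n - 4, 2)%:R) pL3))) => -[|a [|b [|c []]]] //= _.
apply: (canLR (mulKf n4)); rewrite mulNr.
apply/eqP; rewrite subr_eq -!natrM -natrD; apply/eqP; congr (_%:R).
rewrite /L3 /N card_common_nbr.
case: (boolP (triangle a b c)) => [tr | ntr]; last first.
  rewrite muln0 add0n; case: and3P => [[ab bc ca]|_]; last by rewrite mul0n muln0.
  by rewrite card_union_triangle // (negPf ntr) mul1n muln1.
have ab := triangle_meet tr; have bc : meet_in_one b c.
  by apply: (@triangle_meet _ _ _ a); rewrite -triangle_rot.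
have ca : meet_in_one c a by apply: (@triangle_meet _ _ _ b); rewrite triangle_rot.
rewrite ab bc ca card_union_triangle // tr mul1n !muln1.
by rewrite (_ : n - 3 = (n - 4).+1)%N ?binS ?bin1; lia.
Qed.

Hypothesis hn : (5 <= n)%N.
Let pT := planar3_triangle hn.

Lemma planar_crossing_meet :
  planar_crossing e (fun a b : V => (meet_in_one a b)%:R : C).
Proof.
(* The triangles on (a, b) and (b, c) are glued along [b] and [v]; the cyclic boundary order is b,
   c, v, a. *)
pose F2 (s : seq V) : C := if s is [:: b; c; v; a] then
  (triangle b c v)%:R * (triangle b v a)%:R else 0.
have p2 : planar 4 F2.
  by apply: (planar_attach (j := 1) (k := 1) pT pT) => x y [|c []] // [|a []].
have {p2} p3 := planar_rot (isT : (3 <= 4)%N) p2.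
(* The triangle on (c, d) is attached along [c] and [v]. This leaves [v] on the boundary, so it can
   be rotated to the front and summed out. *)
pose F4 (s : seq V) : C := if s is [:: c; d; v; a; b] then
  (triangle c d v)%:R * ((triangle b c v)%:R * (triangle b v a)%:R) else 0.
have p4 : planar 5 F4.
  by apply: (planar_attach (j := 1) (k := 2) pT p3) => x y [|c []] // [|a [|b []]].
have {p3 p4} := planar_sum_front (planar_rot (isT : (3 <= 5)%N) p4).
apply: planar_ext => -[|a [|b [|c [|d []]]]] //= _.
(* Both [a] and [c] are the third side for [b] and [v]; once they agree, [b] and [d] are both the
   third side for [a] and [v]. *)
case: (a =P c) => [<-|ac] /=; last first.
  rewrite mulr0 big1 // => v _; rewrite -!natrM !mulnb.
  case: and3P => // -[_ bc ba]; case: ac.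
  by apply: (triangle_inj ba); rewrite triangleAC.
case: (b =P d) => [<-|bd] /=; last first.
  rewrite mulr0 big1 // => v _; rewrite -!natrM !mulnb.
  case: and3P => // -[ad ab _]; case: bd.
  by apply: (@triangle_inj _ a v); rewrite triangleAC // triangleC.
(* With a = c and b = d the three triangles coincide, and [v] is their common third side. *)
rewrite mulr1 -card_triangle -natr_sum_card; apply: eq_bigr => v _.
rewrite /= (triangleC b a) -(triangle_rot a b).
by case: triangle; rewrite ?mulr1 ?mul0r.
Qed.

Lemma planar_crossing_adj :
  planar_crossing e (fun a b : V => (kneser_adj a b)%:R : C).
Proof.
(* A string from [a] to [c] is placed beside the triangle v, w, b; [c] then crosses [v] and [w] in
   turn, each crossing weighted by meeting in one point. *)
have p0 := planar_tensor (planar2_delta R e) pT.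
pose H1 (s : seq V) : C := if s is [:: a; v; c; w; b] then
  (meet_in_one v c)%:R * ((a == c)%:R * (triangle v w b)%:R) else 0.
have p1 : planar 5 H1.
  apply: (planar_swap_at (i := 1) (j := 2) planar_crossing_meet p0).
  by move=> [|a []] // v c [|w [|b []]].
pose H2 (s : seq V) : C := if s is [:: a; v; w; c; b] then
  (meet_in_one w c)%:R * ((meet_in_one v c)%:R * ((a == c)%:R * (triangle v w b)%:R)) else 0.
have p2 : planar 5 H2.
  apply: (planar_swap_at (i := 2) (j := 1) planar_crossing_meet p1).
  by move=> [|a [|v []]] // w c [|b []].
pose H3 (s : seq V) : C := if s is [:: c; b; a; v; w] then
  (kneser_adj c b)%:R * ((meet_in_one w c)%:R * ((meet_in_one v c)%:R
    * ((a == c)%:R * (triangle v w b)%:R))) else 0.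
have p3 : planar 5 H3.
  apply: (planar_mul (planar2_adj R e) (planar_rot (isT : (2 <= 5)%N) p2)).
  by move=> c b [|a [|v [|w []]]].
(* A second triangle merges [v] and [w] into the last variable [d], which v + w = b forces to equal
   [b]. *)
have p4 := planar_glue2 (k := 3) (m := 1) p3 pT.
(* The factor 4 is the number of [v] meeting both disjoint edges in one point, as in
   [card_meet_both]. *)
have n4 : 4%:R != 0 :> C by rewrite pnatr_eq0.
apply: planar_ext (planar_scale 4%:R^-1 p4) => -[|c [|b [|a [|d []]]]] //= _.
apply: (canLR (mulKf n4)).
have [cb|ncb] := boolP (kneser_adj c b); last first.
  by rewrite mul0r mulr0 big1 // => v _; rewrite big1 // => w _; rewrite !mul0r.
case: (c =P a) => [<-|ca] /=; last first.
  rewrite !mulr0 big1 // => v _; rewrite big1 // => w _.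
  by case: eqP => [ac|_]; [case: ca | rewrite mul0r !mulr0 mul0r].
rewrite eqxx; case: (b =P d) => [<-|bd] /=; last first.
  rewrite !mulr0 big1 // => v _; rewrite big1 // => w _; rewrite !mul1r -!natrM !mulnb.
  case: (boolP (triangle v w b)) => vwb; last by rewrite !andbF.
  case: (boolP (triangle w v d)) => wvd; last by rewrite andbF.
  by case: bd; apply: (triangle_inj vwb); rewrite triangleC.
rewrite !mulr1 -(card_meet_both cb) -natr_sum_card; apply: eq_bigr => v _ /=.
(* That [v] meets [b] in one point is traded for the sum over the at most one [w] with v + w = b. *)
rewrite -mulnb natrM -(card_triangle v b) -natr_sum_card mulr_sumr; apply: eq_bigr => w _ /=.
rewrite !mul1r (triangleC w v) (triangleAC v b) -!natrM !mulnb.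
case: (boolP (triangle v w b)) => vwb; last by rewrite !andbF.
by rewrite (triangle_meet_transfer cb vwb) !andbT andbb.
Qed.

Lemma planar_crossing_one : planar_crossing e (fun _ _ : V => 1 : C).
Proof.
have := planar_add (planar_add (planar_crossing_delta R e) planar_crossing_meet)
  planar_crossing_adj.
apply: planar_ext => -[|a [|b [|c [|d []]]]] //= _; rewrite ?addr0 //.
by rewrite -!mulrDl -!natrD meet_cases.
Qed.

End KneserCrossing.

(* Property (G) for the graphs KG_{n,2} *)
Local Close Scope ring_scope.

Theorem mainTheorem1 (R : realType) (n : nat) (hn : 5 <= n) :
  property_G R (@kneser_adj n).
Proof.
(* Some vertex has to be supplied as the default value of [nth]. *)
have /card_gt0P[B] : (0 < #|[set B : {set 'I_n} | #|B| == 2%N]|)%N.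
  by rewrite card_draws card_ord bin_gt0; lia.
rewrite inE => B2; exact: (property_G_of_crossing (vertex B2) (planar_crossing_one R hn)).
Qed.
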